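(* Let $(L_i)_{i=1}^n$ be a sequence of Markov generators with $L_i\in\mathcal{L}$ for each $i=1,\ldots,n$, and let $D_f$ be the $f$-divergence generated by a strictly convex $f$, where $f$ is assumed to have a derivative at $1$ given by $f'(1)=0$. Then: (a) A minimizer $M^f_n\in\mathcal{L}(\pi)$ of the mapping $$\mathcal{L}(\pi)\ni M\mapsto\sum_{i=1}^nD_f(M\|L_i)\quad\left(\text{resp. }=\sum_{i=1}^nD_{f^*}(L_i\|M)\right)$$ exists and is unique. (b) A minimizer $M^{f^*}_n\in\mathcal{L}(\pi)$ of the mapping $$\mathcal{L}(\pi)\ni M\mapsto\sum_{i=1}^nD_f(L_i\|M)\quad\left(\text{resp. }=\sum_{i=1}^nD_{f^*}(M\|L_i)\right)$$ exists and is unique.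
   Context: $\mathcal{X}$ is a finite set and $\pi$ is a fixed probability distribution on $\mathcal{X}$ with $\pi(x)>0$ for all $x$. $\mathcal{L}$ is the set of Markov infinitesimal generators on $\mathcal{X}$, i.e. $\mathcal{X}\times\mathcal{X}$ real matrices with non-negative off-diagonal entries and all row sums zero. $\mathcal{L}(\pi)\subseteq\mathcal{L}$ is the set of $\pi$-reversible generators, i.e. those $M$ with $\pi(x)M(x,y)=\pi(y)M(y,x)$ for all $x,y$. Throughout, $f:\mathbb{R}_+\to\mathbb{R}_+$ is convex with $f(1)=0$ and grows at most polynomially; its conjugate is $f^*(t):=tf(1/t)$ for $t>0$. For $M,L\in\mathcal{L}$ the $f$-divergence is $$D_f(M\|L):=\sum_{x\in\mathcal{X}}\pi(x)\sum_{y\in\mathcal{X}\setminus\{x\}}L(x,y)\,f\!\left(\frac{M(x,y)}{L(x,y)}\right),$$ with the convention $0f(a/0)=0$ for $a\ge 0$. The paper uses the identity $D_f(M\|L)=D_{f^*}(L\|M)$. The minimizer in (a) is called the $f$-projection centroid and that in (b) the $f^*$-projection centroid of $(L_i)_{i=1}^n$ (with respect to $D_f$).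
   Formalization: 0f(a/0)=0 makes the claim false (M=0 also minimizes (b)); replaced by 0f(a/0)=a·lim f(t)/t, with 0f(a/0)=0 kept only for D_f(M‖L_i), D_{f*}(M‖L_i) when each pair x≠y has some L_i(x,y) or L_i(y,x)>0. Also assumed: n≥1, f right-continuous at 0; f*(0) is the limit in [0,∞]. *)

(* Defs.v *)
From HB Require Import structures.
From mathcomp Require Import all_boot all_order all_algebra.
From mathcomp Require Import all_classical all_reals all_analysis.

Set Implicit Arguments.
Unset Strict Implicit.
Unset Printing Implicit Defensive.

Import Order.TTheory GRing.Theory Num.Theory.
Import numFieldNormedType.Exports.

Local Open Scope classical_set_scope.
Local Open Scope ring_scope.

Section Generators.
Context {R : realType} {X : finType}.

Definition probability_vector (pi : X -> R) : Prop :=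
  (forall x, 0 < pi x) /\ \sum_x pi x = 1.

Definition generator : set (X -> X -> R) :=
  [set M | (forall x y, x != y -> 0 <= M x y) /\
           (forall x, \sum_y M x y = 0)].

Definition reversible_generator (pi : X -> R) : set (X -> X -> R) :=
  [set M | generator M /\ forall x y, pi x * M x y = pi y * M y x].

End Generators.

Section Divergence.
Context {R : realType}.

(* Functions on R_+ = [0, +oo[ are total functions on R whose values at
   negative reals are never used. *)
Definition strictly_convex_nonneg (f : R -> R) : Prop :=
  forall x y t : R, 0 <= x -> 0 <= y -> x != y -> 0 < t -> t < 1 ->
    f (t * x + (1 - t) * y) < t * f x + (1 - t) * f y.

Definition polynomial_growth (f : R -> R) : Prop :=
  exists (k : nat) (C : R), forall t, 0 <= t -> f t <= C * (1 + t ^+ k).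

Local Open Scope ereal_scope.

(* The value f*(0) = lim_(t -> 0+) f*(t) may be +oo (e.g. f t = (t - 1) ^ 2),
   hence the extended codomain. *)
Definition conjugate (f : R -> \bar R) (t : R) : \bar R :=
  if t == 0%R then lim (s%:E * f (s^-1)%R @[s --> 0^'+])
  else t%:E * f (t^-1)%R.

Definition slope_at_infinity (f : R -> \bar R) : \bar R :=
  lim ((t^-1)%:E * f t @[t --> +oo%R]).

(* l f(m / l), with the convention 0 f(m / 0) = m * kappa. *)
Definition fdiv_term (kappa : \bar R) (f : R -> \bar R) (m l : R) : \bar R :=
  if l == 0%R then m%:E * kappa else l%:E * f (m / l)%R.

Definition fdiv_conv (kappa : \bar R) {X : finType} (pi : X -> R)
    (f : R -> \bar R) (M L : X -> X -> R) : \bar R :=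
  \sum_x (pi x)%:E * \sum_(y | y != x) fdiv_term kappa f (M x y) (L x y).

(* The convention 0 f(a / 0) = 0 for all a >= 0. *)
Definition fdiv0 {X : finType} := @fdiv_conv 0 X.

(* The convention 0 f(0 / 0) = 0 and 0 f(a / 0) = lim_(l -> 0+) l f(a / l)
   for a > 0.  The two conventions differ only at pairs with
   L x y = 0 < M x y; only this one makes D_f(M || L) = D_f*(L || M) hold for
   all generators.  Under the other one M = 0 gives D_f(L || M) = 0 for every
   L, so that a nonzero reversible L is not the only minimizer of
   D_f(L || .). *)
Definition fdiv {X : finType} (pi : X -> R) (f : R -> \bar R) :=
  fdiv_conv (slope_at_infinity f) pi f.

Definition is_minimizer {T : Type} (A : set T) (F : T -> \bar R) (M : T) :
  Prop := A M /\ forall N, A N -> F M <= F N.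

End Divergence.

(* Main.v *)
Require Import Defs.
From mathcomp Require Import all_boot all_order all_algebra.
From mathcomp Require Import all_classical all_reals all_analysis.
From mathcomp Require Import lra ring.
Import Order.TTheory GRing.Theory Num.Theory.
Import numFieldNormedType.Exports.
Local Open Scope classical_set_scope.
Local Open Scope ring_scope.

(** Reversibility makes the minimization split into one-dimensional problems.
    A reversible M is determined by its edge flows
    c x y = pi x * M x y = pi y * M y x over unordered pairs x <> y, and these
    are arbitrary nonnegative numbers (the diagonal is then forced by the row
    sums).  The objective is a sum over pairs of functions of one flow each, so
    it has a unique minimizer as soon as every edge function has a unique
    minimizer with a finite value: [separable_has_min].

    An edge function is a finite sum of perspectives, that is of functions
    c |-> w * phi (c / w) with w = pi x * L i x y when L i x y > 0, and of
    linear functions c |-> c * kappa when L i x y = 0, where kappa is the slope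
    of phi at infinity, or 0 under the convention 0 f(a / 0) = 0.  If some rate
    is positive and kappa is finite or meets no zero rate, the sum is continuous,
    coercive and strictly convex where it is finite, hence has a unique
    minimizer: [strict_cost_has_min].  In the two remaining cases the minimizer
    is c = 0: either all rates vanish and kappa > 0, so that the sum is a
    positive multiple of c, or some rate vanishes and kappa is infinite, so that
    the sum is infinite for c > 0.  [weighted_divergence_has_min] joins the three.

    This applies to phi = f and to phi = the conjugate of f, s |-> s f(1/s).
    The conjugate is strictly convex because chords of f reparametrize to chords
    of the conjugate.  It is nonincreasing on ]0, 1], so its limit at 0 exists in
    ]0, +oo]; this limit, [recession], is also the slope of f at infinity.
    Dually the slope of the conjugate at infinity is f 0.  So the terms of
    D_f(M || L) and D_fstar(L || M) agree one by one ([fdiv_term_conjugate]), and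
    the two forms of (a), and of (b), are the same minimization problem.  The
    possible value +oo at 0 is why the one-variable analysis is done for
    functions with values in the extended reals. *)

Set Implicit Arguments.
Unset Strict Implicit.

(** * One-variable minimization *)

Section Costs.
Context {R : realType}.
Implicit Types (h k : R -> \bar R) (c d : R).
Local Open Scope ereal_scope.

(** Only the values of a cost on [0, +oo[ matter.  Composing with the clamp
    c |-> max c 0 turns continuity on the half-line into continuity on R, which
    composes without any subspace topology. *)
Record convex_cost h : Prop := ConvexCost {
  cost_ge0 : forall c, (0 <= c)%R -> 0 <= h c;
  cost_continuous : continuous (fun c => h (Num.max c 0%R));
  cost_midpoint : forall c d, (0 <= c)%R -> (0 <= d)%R ->
    h ((c + d) / 2)%R <= 2^-1%:E * (h c + h d) }.

(** The finiteness conditions make strictness survive the addition of another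
    cost, which may be infinite at points where the first one is finite. *)
Definition strict_cost h : Prop := forall c d, (0 <= c)%R -> (0 <= d)%R ->
  c != d -> h c < +oo -> h d < +oo -> h ((c + d) / 2)%R < 2^-1%:E * (h c + h d).

Definition coercive h : Prop :=
  forall A : R, exists B : R, forall c, (B <= c)%R -> A%:E <= h c.

(** Existence of such a point says that the minimizer over [0, +oo[ exists and is
    unique, with a finite minimum; finiteness is what allows comparing sums of
    minima later. *)
Definition strict_min h c : Prop :=
  [/\ (0 <= c)%R, h c < +oo & forall d, (0 <= d)%R -> d != c -> h c < h d].

(** The distance on the extended reals is defined through [contract]. *)
Lemma contract_continuous : continuous (@contract R).
Proof.
move=> x U /nbhs_ballP[e e0 eU]; apply/nbhs_ballP; exists e => // y xy.
exact: eU.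
Qed.

(** Coercivity confines the search to a segment.  There the extreme value
    theorem, a statement on real functions, is applied to [contract \o h], which
    has the same minimizers since [contract] is increasing.  Two minimizers would
    have a midpoint of smaller cost. *)
Lemma strict_cost_has_min h : convex_cost h -> strict_cost h -> coercive h ->
  (exists2 c, (0 <= c)%R & h c < +oo) -> exists c, strict_min h c.
Proof.
move=> [h0 hc _] hs hcoer [c0 c00 hc0].
have c0fin : h c0 \is a fin_num by rewrite ge0_fin_numE ?h0.
have [B hB] := hcoer (fine (h c0)).
pose b := Num.max B c0.
have b0 : (0 <= b)%R by rewrite le_max c00 orbT.
have [m] : exists2 m, m \in `[0%R, b] & forall t, t \in `[0%R, b] ->
    (contract (h (Num.max m 0)) <= contract (h (Num.max t 0)))%R.
  apply: (@EVT_min _ (fun c => contract (h (Num.max c 0%R)))) => //.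
  apply: continuous_subspaceT => x.
  by apply: (continuous_comp (hc x)); exact: contract_continuous.
rewrite in_itv/= => /andP[m0 mb] mmin.
have hm t : (0 <= t)%R -> h m <= h t.
  move=> t0; have [tb|/ltW bt] := leP t b.
    have := mmin t; rewrite in_itv/= t0 tb le_contract => /(_ isT).
    by rewrite !max_l.
  have := mmin c0; rewrite in_itv/= c00 le_max lexx orbT le_contract => /(_ isT).
  rewrite !max_l // => /le_trans; apply.
  by rewrite -(fineK c0fin); apply: hB; rewrite (le_trans _ bt)// le_max lexx.
exists m; split => // [|d d0 dm]; first exact: le_lt_trans (hm _ c00) hc0.
rewrite lt_neqAle hm // andbT; apply/eqP => hmd.
have hmfin : h m < +oo by exact: le_lt_trans (hm _ c00) hc0.
have := hs d m d0 m0 dm; rewrite -hmd => /(_ hmfin hmfin).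
apply/negP; rewrite -leNgt.
have hmf : h m \is a fin_num by rewrite ge0_fin_numE ?h0.
apply: le_trans (hm _ _); last by rewrite divr_ge0 ?addr_ge0.
by rewrite -(fineK hmf) -EFinD -EFinM lee_fin; lra.
Qed.

Lemma boundary_strict_min h : h 0%R < +oo -> (forall c, (0 < c)%R -> h 0%R < h c) ->
  strict_min h 0%R.
Proof. by move=> h0 hc; split=> // d d0 dn; apply: hc; rewrite lt_neqAle eq_sym dn. Qed.

Lemma mean_diag (x : \bar R) : 2^-1%:E * (x + x) = x.
Proof.
case: x => [r| |] /=; first by rewrite -EFinD -EFinM; congr EFin; lra.
- by rewrite /= mulry gtr0_sg ?mul1e// invr_gt0.
- by rewrite /= mulrNy gtr0_sg ?mul1e// invr_gt0.
Qed.

Lemma convex_costD h k : convex_cost h -> convex_cost k -> convex_cost (h \+ k).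
Proof.
move=> [h0 hc hm] [k0 kc km]; split => [c c0|x|c d c0 d0].
- by rewrite adde_ge0 ?h0 ?k0.
- have m0 : (0 <= Num.max x 0)%R by rewrite le_max lexx orbT.
  by apply: cvgeD; [rewrite ge0_adde_def ?inE ?h0 ?k0|exact: hc|exact: kc].
- by rewrite addeACA ge0_muleDr ?adde_ge0 ?h0 ?k0// leeD ?hm ?km.
Qed.

Lemma strict_costD h k : convex_cost h -> convex_cost k -> strict_cost h ->
  strict_cost (h \+ k).
Proof.
move=> [h0 _ _] [k0 _ km] hs c d c0 d0 cd.
have fin u : (0 <= u)%R -> h u + k u < +oo -> h u < +oo /\ k u < +oo.
  move=> u0 hk; split; apply: le_lt_trans hk.
    by rewrite leeDl ?k0.
  by rewrite leeDr ?h0.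
move=> /(fin _ c0)[hc kc] /(fin _ d0)[hd kd].
rewrite addeACA ge0_muleDr ?adde_ge0 ?h0 ?k0//.
have mid0 : (0 <= (c + d) / 2)%R by rewrite divr_ge0 ?addr_ge0.
rewrite lte_leD ?hs ?km// ge0_fin_numE ?k0//.
apply: le_lt_trans (km _ _ c0 d0) _.
have kcf : k c \is a fin_num by rewrite ge0_fin_numE ?k0.
have kdf : k d \is a fin_num by rewrite ge0_fin_numE ?k0.
by rewrite -(fineK kcf) -(fineK kdf) -EFinD -EFinM ltry.
Qed.

Lemma coerciveD h k : (forall c, (0 <= c)%R -> 0 <= k c) -> coercive h ->
  coercive (h \+ k).
Proof.
move=> k0 hc A; have [B hB] := hc A; exists (Num.max B 0%R) => c.
by rewrite ge_max => /andP[Bc c0]; rewrite (le_trans (hB _ Bc))// leeDl ?k0.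
Qed.

Lemma convex_cost0 : convex_cost (cst 0).
Proof.
by split => [//|x|c d _ _] /=; [exact: cvg_cst|rewrite adde0 mule0].
Qed.

Lemma convex_cost_sum (J : finType) (P : pred J) (h : J -> R -> \bar R) :
  (forall j, P j -> convex_cost (h j)) ->
  convex_cost (fun c => \sum_(j | P j) h j c).
Proof.
move=> hh.
rewrite (_ : (fun c => _) = \big[(fun u v : R -> \bar R => u \+ v)/cst 0]_(j | P j) h j).
  by elim/big_ind : _ => //; [exact: convex_cost0|exact: convex_costD].
by apply/funext => c; elim/big_ind2 : _ => // x1 x2 y1 y2 <- <-.
Qed.

(** One strict and coercive summand is enough: the others, being nonnegative
    convex costs, preserve both properties. *)
Lemma sum_has_min (J : finType) (h : J -> R -> \bar R) (i : J) :
  (forall j, convex_cost (h j)) -> strict_cost (h i) -> coercive (h i) ->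
  (exists2 c, (0 <= c)%R & \sum_j h j c < +oo) ->
  exists c, strict_min (fun c => \sum_j h j c) c.
Proof.
move=> hh hs hc fin.
have E : (fun c => \sum_j h j c) = h i \+ (fun c => \sum_(j | j != i) h j c).
  by apply/funext => c; rewrite (bigD1 i).
have hr : convex_cost (fun c => \sum_(j | j != i) h j c) by exact: convex_cost_sum.
apply: strict_cost_has_min => //; rewrite E.
- exact: convex_costD.
- exact: strict_costD.
- by apply: coerciveD => //; exact: cost_ge0.
Qed.

Lemma convex_cost_linear (a : R) : (0 <= a)%R -> convex_cost (fun c => (a * c)%:E).
Proof.
move=> a0; split => [c c0|x|c d _ _] /=; first by rewrite lee_fin mulr_ge0.
  apply: cvg_EFin; first exact: nearW.
  apply: cvgMr; apply: continuous_max; [exact: cvg_id|exact: cvg_cst].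
by rewrite -EFinD -EFinM lee_fin; lra.
Qed.

Lemma cost_scale h (a t : R) : (0 < a)%R -> (0 < t)%R -> convex_cost h ->
  convex_cost (fun c => a%:E * h (c / t)%R).
Proof.
move=> a0 t0 [h0 hc hm]; split => [c c0|x|c d c0 d0].
- by rewrite mule_ge0 ?lee_fin ?(ltW a0)// h0// divr_ge0 // ltW.
- apply: cvgeZl => //.
  have maxE y : (Num.max y 0 / t = Num.max (y / t) 0)%R.
    by rewrite maxr_pMl ?mul0r// invr_ge0 ltW.
  under eq_fun do rewrite maxE.
  rewrite maxE.
  have tc : {for x, continuous (fun y : R => (y / t)%R)}.
    by apply: cvgM; [exact: cvg_id|exact: cvg_cst].
  have /= := @continuous_comp _ _ _ _ (fun y : R => h (Num.max y 0%R)) x tc (hc _).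
  exact.
- have u0 v : (0 <= v -> 0 <= v / t)%R by move=> ?; rewrite divr_ge0 // ltW.
  rewrite (_ : ((c + d) / 2 / t = (c / t + d / t) / 2)%R); last by rewrite -mulrDl mulrAC.
  rewrite -ge0_muleDr ?h0 ?u0// muleCA lee_pmul2l ?lte_fin//.
  by apply: hm; exact: u0.
Qed.

Lemma strict_scale h (a t : R) : (0 < a)%R -> (0 < t)%R -> convex_cost h ->
  strict_cost h -> strict_cost (fun c => a%:E * h (c / t)%R).
Proof.
move=> a0 t0 [h0 _ _] hs c d c0 d0 cd.
have u0 v : (0 <= v -> 0 <= v / t)%R by move=> ?; rewrite divr_ge0 // ltW.
have fin v : (0 <= v)%R -> a%:E * h (v / t)%R < +oo -> h (v / t)%R < +oo.
  by move=> v0; case: (h (v / t)%R) => [r _|| _]; rewrite ?ltry ?ltNyr// gt0_muley.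
move=> /(fin _ c0) hcf /(fin _ d0) hdf.
rewrite (_ : ((c + d) / 2 / t = (c / t + d / t) / 2)%R); last by rewrite -mulrDl mulrAC.
rewrite -ge0_muleDr ?h0 ?u0// muleCA lte_pmul2l ?lte_fin//.
apply: hs => //; [exact: u0|exact: u0|].
by apply: contra cd => /eqP /mulIf ->//; rewrite invr_neq0 ?gt_eqF.
Qed.

Lemma coercive_scale h (a t : R) : (0 < a)%R -> (0 < t)%R ->
  coercive h -> coercive (fun c => a%:E * h (c / t)%R).
Proof.
move=> a0 t0 hc A; have [B hB] := hc (A / a)%R; exists (B * t)%R => c Bc.
rewrite (_ : A = a * (A / a))%R; last by rewrite mulrCA divff ?mulr1 ?gt_eqF.
by rewrite EFinM lee_pmul2l ?lte_fin// hB// ler_pdivlMr.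
Qed.
End Costs.

(** * Sums of perspectives of a divergence kernel *)

Section Perspective.
Context {R : realType}.
Local Open Scope ereal_scope.

(** The properties shared by f and its conjugate; the conjugate may be infinite
    at 0. *)
Record divergence_kernel (phi : R -> \bar R) : Prop := DivergenceKernel {
  kernel_cost : convex_cost phi;
  kernel_strict : strict_cost phi;
  kernel_coercive : coercive phi;
  kernel_fin : forall t, (0 < t)%R -> phi t < +oo }.

Variables (phi : R -> \bar R) (kappa : \bar R).
Hypotheses (hphi : divergence_kernel phi) (kappa0 : 0 <= kappa).

Lemma fdiv_term_ge0 m l : (0 <= m)%R -> (0 <= l)%R ->
  0 <= fdiv_term kappa phi m l.
Proof.
move=> m0 l0; rewrite /fdiv_term; case: ifPn => _; first by rewrite mule_ge0.
by rewrite mule_ge0 ?lee_fin// (cost_ge0 (kernel_cost hphi)) ?divr_ge0.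
Qed.

Lemma weighted_term_pos (p l c : R) : (0 < p)%R -> (0 < l)%R ->
  p%:E * fdiv_term kappa phi (c / p) l = (p * l)%:E * phi (c / (p * l))%R.
Proof.
move=> p0 l0; rewrite /fdiv_term gt_eqF// muleA EFinM.
by rewrite invfM mulrA.
Qed.

Lemma weighted_term0 (p c : R) : (0 < p)%R ->
  p%:E * fdiv_term kappa phi (c / p) 0 = c%:E * kappa.
Proof.
move=> p0; rewrite /fdiv_term eqxx muleA -EFinM mulrCA divff ?mulr1//.
by rewrite gt_eqF.
Qed.

(** The function minimized is, for J the set of directed rates along one edge,
    what the divergence pays for the flow c through that edge.  With a zero rate
    and an infinite slope it is not continuous at 0, but then c = 0 is the only
    point of finite cost; finiteness there is the reason for requiring [phi 0] or
    [kappa] to be finite.  Edges without any positive rate cost a multiple of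
    [c * kappa], whence the alternative in the last hypothesis. *)
Lemma weighted_divergence_has_min (J : finType) (p l : J -> R) :
  (forall j, 0 < p j)%R -> (forall j, 0 <= l j)%R ->
  phi 0%R < +oo \/ kappa < +oo ->
  (exists j, (0 < l j)%R) \/ (0 < kappa /\ exists j : J, True) ->
  exists c, strict_min
    (fun c => \sum_j (p j)%:E * fdiv_term kappa phi (c / p j) (l j)) c.
Proof.
move=> p0 l0 fin charged.
set h := (h in strict_min h).
have term0 j c : (0 <= c)%R ->
    0 <= (p j)%:E * fdiv_term kappa phi (c / p j) (l j).
  by move=> c0; rewrite mule_ge0 ?lee_fin ?(ltW (p0 j))// fdiv_term_ge0// divr_ge0// ltW.
(* All rates vanish: the function is a positive multiple of c. *)
have [[i li]|nopos] := pselect (exists j, (0 < l j)%R); last first.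
  have lE j : l j = 0%R.
    apply/eqP; rewrite eq_le l0 andbT leNgt; apply/negP => lj.
    by apply: nopos; exists j.
  have [[i li]|[k0 [i _]]] := charged; first by case: nopos; exists i.
  exists 0%R; apply: boundary_strict_min => [|c c0]; rewrite /h.
    rewrite big1 ?ltry// => j _; by rewrite lE weighted_term0// mul0e.
  rewrite big1 => [|j _]; last by rewrite lE weighted_term0// mul0e.
  rewrite (bigD1 i)//= lE weighted_term0//.
  apply: (@lt_le_trans _ _ (c%:E * kappa)); first by rewrite mule_gt0.
  by rewrite leeDl// sume_ge0// => j _; apply: term0; exact: ltW.
(* A zero rate and an infinite slope: any c > 0 has infinite cost. *)
have [[kinf [k lk]]|reg] := pselect (kappa = +oo /\ exists j, l j = 0%R).
  have phi0 : phi 0%R < +oo by case: fin => //; rewrite kinf ltxx.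
  exists 0%R.
  have h0 : h 0%R < +oo.
    apply: lte_sum_pinfty => j _.
    have := l0 j; rewrite le_eqVlt => /predU1P[<-|lj].
      by rewrite weighted_term0// mul0e ltry.
    rewrite weighted_term_pos// mul0r.
    have : phi 0%R \is a fin_num by rewrite ge0_fin_numE// (cost_ge0 (kernel_cost hphi)).
    by move=> /fineK <-; rewrite -EFinM ltry.
  apply: boundary_strict_min => // c c0; apply: (lt_le_trans h0).
  rewrite /h (bigD1 k)//= lk weighted_term0//.
  apply: (@le_trans _ _ (c%:E * kappa)); first by rewrite kinf gt0_muley ?leey.
  by rewrite leeDl// sume_ge0// => j _; apply: term0; exact: ltW.
(* Otherwise every term is a convex cost, and the one of a positive rate is
   strict and coercive. *)
have regj j : (0 < l j)%R \/ l j = 0%R /\ kappa \is a fin_num.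
  have := l0 j; rewrite le_eqVlt => /predU1P[lj|]; [right|by left].
  split=> //; rewrite ge0_fin_numE// ltey; apply/eqP => kinf.
  by apply: reg; split=> //; exists j.
rewrite /h; apply: (@sum_has_min _ _ _ i) => [j| | |].
- have [lj|[lj kf]] := regj j.
    under eq_fun => c do rewrite weighted_term_pos//.
    by apply: cost_scale (kernel_cost hphi); exact: mulr_gt0.
  rewrite lj (_ : (fun c => _) = (fun c => (fine kappa * c)%:E)).
    by apply: convex_cost_linear; exact: fine_ge0.
  by apply/funext => c; rewrite weighted_term0// mulrC EFinM fineK.
- under eq_fun do rewrite weighted_term_pos//.
  apply: strict_scale (kernel_cost hphi) (kernel_strict hphi); exact: mulr_gt0.
- under eq_fun do rewrite weighted_term_pos//.
  by apply: coercive_scale (kernel_coercive hphi); exact: mulr_gt0.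
- exists 1%R => //; apply: lte_sum_pinfty => j _.
  have [lj|[-> kf]] := regj j.
    rewrite weighted_term_pos//.
    have q0 : (0 < 1 / (p j * l j))%R by rewrite divr_gt0 ?mulr_gt0.
    have pf : phi (1 / (p j * l j))%R \is a fin_num.
      by rewrite ge0_fin_numE ?(kernel_fin hphi)// (cost_ge0 (kernel_cost hphi)) ?ltW.
    by rewrite -(fineK pf) -EFinM ltry.
  by rewrite weighted_term0// mul1e -(fineK kf) ltry.
Qed.

End Perspective.

(** * Reversible generators as families of edge flows *)

Section Separable.
Context {R : realType} {X : finType}.
Variable pi : X -> R.
Hypothesis pi_gt0 : forall x, 0 < pi x.
Variable a : X -> X -> R -> \bar R.
Local Open Scope ereal_scope.
Hypothesis a_ge0 : forall x y c, x != y -> (0 <= c)%R -> 0 <= a x y c.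

Definition edge_cost x y c := a x y c + a y x c.

Definition total_cost (M : X -> X -> R) : \bar R :=
  \sum_x \sum_(y | y != x) a x y (pi x * M x y)%R.

Lemma total_cost_ge0 M : generator M -> 0 <= total_cost M.
Proof.
move=> [M0 _]; apply: sume_ge0 => x _; apply: sume_ge0 => y yx.
rewrite a_ge0 1?eq_sym// mulr_ge0 ?M0 1?eq_sym//; exact: ltW.
Qed.

(** Counting every edge from both of its ends symmetrizes the sum without having
    to choose an orientation of the edges. *)
Lemma total_cost_double M : reversible_generator pi M ->
  total_cost M + total_cost M =
  \sum_(e : X * X | e.2 != e.1) edge_cost e.1 e.2 (pi e.1 * M e.1 e.2)%R.
Proof.
move=> [_ rev].
have E : total_cost M = \sum_x \sum_(y | y != x) a y x (pi x * M x y)%R.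
  rewrite /total_cost (exchange_big_dep xpredT)//=.
  apply: eq_bigr => x _.
  by apply: eq_big => [y|y _]; [rewrite eq_sym|rewrite rev].
rewrite {2}E /total_cost -big_split/=.
rewrite -(pair_big_dep xpredT (fun x y => y != x)
  (fun x y => edge_cost x y (pi x * M x y)%R)).
by apply: eq_bigr => x _; rewrite -big_split.
Qed.

(** Minimizing twice the cost is minimizing the cost, also when it is +oo. *)
Lemma lee_double (u v : \bar R) : 0 <= u -> 0 <= v -> (u + u <= v + v) = (u <= v).
Proof.
move: u v => [u| |] [v| |] //= _ _.
- by rewrite -!EFinD !lee_fin; apply/idP/idP; lra.
- by rewrite !leey.
Qed.

(** Inverse of the passage from a reversible generator to its edge flows
    [pi x * M x y]; the diagonal is the one forced by the row sums. *)
Definition edge_generator (m : X -> X -> R) x y : R :=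
  (if y == x then - \sum_(z | z != x) m x z / pi x else m x y / pi x)%R.

Lemma edge_generatorE m x y : y != x -> (pi x * edge_generator m x y)%R = m x y.
Proof.
by move=> /negbTE yx; rewrite /edge_generator yx mulrCA divff ?mulr1// gt_eqF.
Qed.

Lemma edge_generator_reversible (m : X -> X -> R) :
  (forall x y, x != y -> 0 <= m x y)%R -> (forall x y, x != y -> m x y = m y x) ->
  reversible_generator pi (edge_generator m).
Proof.
move=> m0 msym; split; first split=> [x y xy|x].
- rewrite /edge_generator eq_sym (negbTE xy) divr_ge0 ?m0//; exact: ltW.
- rewrite (bigD1 x)//= {1}/edge_generator eqxx.
  rewrite [X in (_ + X)%R](eq_bigr (fun z => m x z / pi x)%R) ?addNr// => z zx.
  by rewrite /edge_generator (negbTE zx).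
- move=> x y; have [->//|xy] := eqVneq x y.
  by rewrite !edge_generatorE// 1?eq_sym// msym.
Qed.

Lemma generator_ext (M N : X -> X -> R) : generator M -> generator N ->
  (forall x y, x != y -> M x y = N x y) -> M = N.
Proof.
move=> [_ M0] [_ N0] MN; apply/funext => x; apply/funext => y.
have [<-|] := eqVneq x y; last exact: MN.
have := etrans (M0 x) (esym (N0 x)); rewrite (bigD1 x)//= [in RHS](bigD1 x)//=.
rewrite (eq_bigr (N x)); first by move=> /addIr.
by move=> z zx; rewrite MN// eq_sym.
Qed.

(** The flows minimizing each edge cost are symmetric, because the edge cost is
    and its minimizer is unique; so they come from a reversible generator.  Any
    other reversible generator differs from it on some edge, where it is strictly
    more expensive, and the finiteness of the minima lets this strict inequality
    pass to the sum. *)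
Lemma separable_has_min :
  (forall x y, x != y -> exists c, strict_min (edge_cost x y) c) ->
  exists! M, is_minimizer (reversible_generator pi) total_cost M.
Proof.
move=> hmin.
have [m0 m0P] : {m0 : X * X -> R & forall e, e.1 != e.2 ->
    strict_min (edge_cost e.1 e.2) (m0 e)}.
  apply: (@choice _ _ (fun e c => e.1 != e.2 -> strict_min (edge_cost e.1 e.2) c)).
  move=> [x y] /=; have [_|xy] := eqVneq x y; first by exists 0%R.
  by have [c cP] := hmin _ _ xy; exists c.
pose m x y := m0 (x, y).
have mP x y : x != y -> strict_min (edge_cost x y) (m x y) by exact: (m0P (x, y)).
have msym x y : x != y -> m x y = m y x.
  move=> xy; have [u0 _ uP] := mP x y xy.
  have [v0 _ vP] : strict_min (edge_cost y x) (m y x) by apply: mP; rewrite eq_sym.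
  apply/eqP/negPn/negP => uv.
  have := uP (m y x) v0; rewrite eq_sym uv => /(_ isT).
  have := vP (m x y) u0 uv; rewrite /edge_cost addeC [X in _ < X]addeC.
  by move=> /lt_trans h /h; rewrite ltxx.
pose M := edge_generator m.
have MR : reversible_generator pi M.
  by apply: edge_generator_reversible => // x y /mP[].
have ge0 N e : generator N -> e.2 != e.1 -> (0 <= pi e.1 * N e.1 e.2)%R.
  by move=> [N0 _] e12; rewrite mulr_ge0 ?N0 1?eq_sym//; exact: ltW.
have ME e : e.2 != e.1 -> (pi e.1 * M e.1 e.2)%R = m e.1 e.2.
  exact: edge_generatorE.
have Mle N e : generator N -> e.2 != e.1 ->
    edge_cost e.1 e.2 (pi e.1 * M e.1 e.2)%R <= edge_cost e.1 e.2 (pi e.1 * N e.1 e.2)%R.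
  move=> NG e12; have e21 : e.1 != e.2 by rewrite eq_sym.
  have [_ _ eP] := mP _ _ e21.
  rewrite ME//; have [->//|ne] := eqVneq (pi e.1 * N e.1 e.2)%R (m e.1 e.2).
  by apply/ltW/eP => //; exact: ge0.
exists M; split.
  split=> // N [NG NR]; rewrite -lee_double ?total_cost_ge0//; last by case: MR.
  by rewrite !total_cost_double// lee_sum// => e; exact: Mle.
move=> N [[NG NR] Nmin].
apply: generator_ext => //; first by case: MR.
move=> x y xy; apply/eqP/negPn/negP => MN.
have := Nmin _ MR; apply/negP; rewrite -ltNge.
rewrite ltNge -lee_double ?total_cost_ge0//; last by case: MR.
rewrite -ltNge !total_cost_double//.
rewrite (bigD1 (x, y)) 1?eq_sym//= [X in _ < X](bigD1 (x, y)) 1?eq_sym//=.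
have [_ mfin mlt] := mP x y xy.
have yx : y != x by rewrite eq_sym.
apply: lte_leD.
- apply/fin_numPlt; rewrite (lt_le_trans (ltNyr 0))/= ?sume_ge0//.
    apply: lte_sum_pinfty => e /andP[e12 _].
    by rewrite ME//; have [] := mP e.1 e.2; rewrite 1?eq_sym.
  move=> e /andP[e12 _]; have MG : generator M by case: MR.
  by rewrite adde_ge0 ?a_ge0 ?ge0// eq_sym.
- rewrite (ME (x, y))//=; apply: mlt; first exact: (ge0 N (x, y)).
  rewrite -(ME (x, y))//=; apply: contra MN => /eqP/mulfI -> //.
  by rewrite gt_eqF.
- by apply: lee_sum => e /andP[e12 _]; exact: Mle.
Qed.

End Separable.

(** * Strictly convex functions on the half-line and their conjugates *)

Section ConvexFunction.
Context {R : realType}.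
Variable f : R -> R.
Hypotheses (f_ge0 : forall t, 0 <= t -> 0 <= f t)
  (f_convex : strictly_convex_nonneg f) (f1 : f 1 = 0).

Lemma convex_le x y (t : R) : 0 <= x -> 0 <= y -> 0 <= t -> t <= 1 ->
  f (t * x + (1 - t) * y) <= t * f x + (1 - t) * f y.
Proof.
move=> x0 y0; rewrite le_eqVlt => /predU1P[<- _|t0].
  by rewrite !mul0r !subr0 !mul1r !add0r.
rewrite le_eqVlt => /predU1P[->|t1].
  by rewrite subrr !mul0r !mul1r !addr0.
have [->|xy] := eqVneq x y; last by rewrite ltW ?f_convex.
by rewrite -!mulrDl addrC subrK !mul1r.
Qed.

(** Convexity in a division-free form, usable by linear arithmetic. *)
Lemma chord_lt (a b c : R) : 0 <= a -> a < b -> b < c ->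
  f b * (c - a) < f a * (c - b) + f c * (b - a).
Proof.
move=> a0 ab bc.
have ca : 0 < c - a by lra.
rewrite -ltr_pdivlMr//.
have := f_convex a0 (_ : 0 <= c) _ (_ : 0 < (c - b) / (c - a)) _.
have -> : (c - b) / (c - a) * a + (1 - (c - b) / (c - a)) * c = b.
  by field; rewrite gt_eqF.
have -> : (c - b) / (c - a) * f a + (1 - (c - b) / (c - a)) * f c =
   (f a * (c - b) + f c * (b - a)) / (c - a) by field; rewrite gt_eqF.
apply; [lra|by rewrite lt_eqF//; lra|by rewrite divr_gt0//; lra|].
by rewrite ltr_pdivrMr//; lra.
Qed.

Lemma f_gt0 (t : R) : 0 <= t -> t != 1 -> 0 < f t.
Proof.
move=> t0 t1; rewrite lt_neqAle f_ge0// andbT eq_sym; apply/eqP => ft.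
have := @f_convex t 1 (1/2) t0 ler01 t1; rewrite ft f1.
have := @f_ge0 (1 / 2 * t + (1 - 1 / 2) * 1); lra.
Qed.

(** A convex function lies below its chords, and above the prolongations of its
    chords.  For the points 0, x, 2x and |y - x| <= x, this pins
    |f y - f x| below C |y - x| / x, with C as in the proof. *)
Lemma continuous_gt0 (x : R) : 0 < x -> f y @[y --> x] --> f x.
Proof.
move=> x0.
pose C := f 0 + f (2 * x) + f x.
have C0 : 0 < C + 1 by rewrite /C; have := @f_ge0 0; have := @f_ge0 (2*x); have := @f_ge0 x; lra.
have up s : 0 <= s -> s <= 1 -> `|f x - f (x + s * x)| <= s * C /\
   `|f x - f (x - s * x)| <= s * C.
  move=> s0 s1.
  have i0 := f_ge0 (lexx 0).
  have i2 : 0 <= f (2 * x) by apply: f_ge0; lra.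
  have ix : 0 <= f x by apply: f_ge0; lra.
  have sx0 : 0 <= x - s * x by nra.
  have sx1 : 0 <= x + s * x by nra.
  have s1' : 0 < 1 + s by lra.
  have h1 : f (x + s * x) <= s * f (2 * x) + (1 - s) * f x.
    have <- : s * (2 * x) + (1 - s) * x = x + s * x by ring.
    by apply: convex_le => //; lra.
  have h2 : f (x - s * x) <= s * f 0 + (1 - s) * f x.
    have <- : s * 0 + (1 - s) * x = x - s * x by ring.
    by apply: convex_le => //; lra.
  have k0 : 0 <= (1 + s)^-1 by rewrite invr_ge0; lra.
  have k1 : (1 + s)^-1 <= 1 by rewrite invf_le1//; lra.
  have h3 : (1 + s) * f x <= f (x + s * x) + s * f 0.
    rewrite -ler_pdivlMl//.
    have {1}-> : x = (1 + s)^-1 * (x + s * x) + (1 - (1 + s)^-1) * 0.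
      by field; rewrite gt_eqF.
    apply: le_trans (convex_le _ _ _ _) _ => //.
    by rewrite le_eqVlt; apply/predU1P; left; field; rewrite gt_eqF.
  have h4 : (1 + s) * f x <= f (x - s * x) + s * f (2 * x).
    rewrite -ler_pdivlMl//.
    have {1}-> : x = (1 + s)^-1 * (x - s * x) + (1 - (1 + s)^-1) * (2 * x).
      by field; rewrite gt_eqF.
    apply: le_trans (convex_le _ _ _ _) _ => //; first lra.
    by rewrite le_eqVlt; apply/predU1P; left; field; rewrite gt_eqF.
  by rewrite /C !ler_norml; split; apply/andP; split; nra.
apply/cvgrPdist_le => e e0.
near=> y.
have d0 : `|x - y| / x <= 1.
  rewrite ler_pdivrMr// mul1r; near: y; apply: cvgr_dist_le => //; exact: cvg_id.
have d1 : `|x - y| <= e * x / (C + 1).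
  near: y; apply: cvgr_dist_le; first exact: cvg_id.
  by rewrite divr_gt0// mulr_gt0.
have s0 : 0 <= `|x - y| / x by rewrite divr_ge0// ltW.
apply: (@le_trans _ _ (`|x - y| / x * C)).
  have [+ +] := up _ s0 d0; rewrite divfK ?gt_eqF//.
  have [xy|yx] := leP x y.
    have -> : `|x - y| = y - x by rewrite distrC ger0_norm ?subr_ge0.
    by rewrite (_ : x + (y - x) = y)//; ring.
  have -> : `|x - y| = x - y by rewrite gtr0_norm ?subr_gt0.
  by rewrite (_ : x - (x - y) = y)//; ring.
rewrite mulrAC ler_pdivrMr//.
move: d1; rewrite ler_pdivlMr//; have := normr_ge0 (x - y); lra.
Unshelve. all: by end_near. Qed.

Lemma midpoint_lt x (y : R) : 0 <= x -> 0 <= y -> x != y ->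
  f ((x + y) / 2) < 2^-1 * (f x + f y).
Proof.
move=> x0 y0 xy; have := f_convex x0 y0 xy (_ : 0 < 2^-1).
have -> : 2^-1 * x + (1 - 2^-1) * y = (x + y) / 2 by field.
have -> : 2^-1 * f x + (1 - 2^-1) * f y = 2^-1 * (f x + f y) by field.
by apply; lra.
Qed.

(** The conjugate of f on ]0, +oo[. *)
Definition fstar (s : R) := s * f s^-1.

(** The inverse of the midpoint of x and y is the barycenter of 1/x and 1/y with
    weights x / (x + y) and y / (x + y). *)
Lemma fstar_midpoint_lt x (y : R) : 0 < x -> 0 < y -> x != y ->
  fstar ((x + y) / 2) < 2^-1 * (fstar x + fstar y).
Proof.
move=> x0 y0 xy.
have xy0 : 0 < x + y by lra.
have t0 : 0 < x / (x + y) by rewrite divr_gt0.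
have t1 : x / (x + y) < 1 by rewrite ltr_pdivrMr//; lra.
have := f_convex (_ : 0 <= x^-1) (_ : 0 <= y^-1) _ t0 t1.
rewrite !invr_ge0 !ltW// => /(_ isT isT).
have -> : x^-1 != y^-1 by apply: contra xy => /eqP/invr_inj ->.
move=> /(_ isT).
have -> : x / (x + y) * x^-1 + (1 - x / (x + y)) * y^-1 = ((x + y) / 2)^-1.
  by field; rewrite !gt_eqF.
rewrite /fstar -(ltr_pM2l (_ : 0 < (x + y) / 2)); last by rewrite divr_gt0.
move=> /lt_le_trans; apply.
by rewrite le_eqVlt; apply/predU1P; left; field; rewrite gt_eqF.
Qed.

(** Through s |-> 1/s this says that f t / t is nondecreasing for t >= 1, which
    follows from the chord of f starting at its zero t = 1. *)
Lemma fstar_nonincreasing (s s' : R) : 0 < s -> s <= s' -> s' <= 1 -> fstar s' <= fstar s.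
Proof.
move=> s0; rewrite le_eqVlt => /predU1P[->//|ss'].
have s'0 : 0 < s' by lra.
rewrite le_eqVlt => /predU1P[s'1|s'1].
  by rewrite /fstar s'1 invr1 f1 mulr0 mulr_ge0 ?f_ge0 ?invr_ge0// ltW.
have := @chord_lt 1 s'^-1 s^-1 ler01; rewrite invf_gt1// s'1 ltf_pV2// ss' => /(_ isT isT).
rewrite f1 mul0r add0r /fstar => h.
have fs : 0 <= f s^-1 by rewrite f_ge0// invr_ge0 ltW.
have fs' : 0 <= f s'^-1 by rewrite f_ge0// invr_ge0 ltW.
have h' : s' * f s'^-1 * (1 - s) <= s * f s^-1 * (1 - s').
  move: h; rewrite -(ltr_pM2l (_ : 0 < s * s')) ?mulr_gt0// => /ltW.
  have -> : s * s' * (f s'^-1 * (s^-1 - 1)) = s' * f s'^-1 * (1 - s).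
    by field; rewrite gt_eqF.
  have -> // : s * s' * (f s^-1 * (s'^-1 - 1)) = s * f s^-1 * (1 - s').
  by field; rewrite gt_eqF.
have : 0 <= s * f s^-1 by rewrite mulr_ge0// ltW.
have : 0 < 1 - s by lra.
nra.
Qed.

(** Both the limit of the conjugate at 0 and the limit of f t / t at infinity. *)
Definition recession : \bar R := ereal_sup [set (fstar s)%:E | s in `]0, 1[].

Lemma fstar_cvg0 : (fstar s)%:E @[s --> 0^'+] --> recession.
Proof.
apply: (@nonincreasing_at_right_cvge _ (fun s => (fstar s)%:E) 0 (BLeft 1)).
  by rewrite bnd_simp.
move=> s s'; rewrite !in_itv/= => /andP[s0 s1] /andP[s'0 s'1] ss'.
by rewrite lee_fin fstar_nonincreasing// ltW.
Qed.

Lemma fstar_le_recession (s : R) : 0 < s -> s < 1 -> ((fstar s)%:E <= recession)%E.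
Proof.
by move=> s0 s1; apply: ereal_sup_ubound; exists s => //=; rewrite in_itv/= s0.
Qed.

(** Beyond b, f stays above the line through (a, f a) and (b, f b), so f t / t
    eventually exceeds any number smaller than the slope of this line. *)
Lemma chord_slope_le_recession (a b : R) : 0 <= a -> a < b ->
  (((f b - f a) / (b - a))%:E <= recession)%E.
Proof.
move=> a0 ab; have ba : 0 < b - a by lra.
rewrite leNgt; apply/negP => lt.
set q := (f b - f a) / (b - a) in lt.
have rge0 : (0 <= recession)%E.
  apply: (@le_trans _ _ (fstar 2^-1)%:E); last by apply: fstar_le_recession; lra.
  by rewrite lee_fin /fstar invrK mulr_ge0 ?invr_ge0// f_ge0.
have kf : recession \is a fin_num by rewrite ge0_fin_numE// (lt_trans lt)// ltry.
move: lt; rewrite -(fineK kf) lte_fin; set k := fine recession => kq.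
have qk : 0 < q - k by lra.
(* Past this point the line of slope q is above the line of slope k through the
   origin, while f is above the first and below the second. *)
pose s := `|(q * a - f a) / (q - k)| + b + 2.
have sb : b < s by rewrite /s; have := normr_ge0 ((q * a - f a) / (q - k)); lra.
have s1 : 1 < s by rewrite /s; have := normr_ge0 ((q * a - f a) / (q - k)); lra.
have s0 : 0 < s by lra.
have fsk : f s <= k * s.
  have := @fstar_le_recession s^-1; rewrite invr_gt0 invf_lt1// => /(_ s0 s1).
  by rewrite -(fineK kf) lee_fin /fstar invrK mulrC ler_pdivrMr.
have fsq : f a + q * (s - a) <= f s.
  have := chord_lt a0 ab sb.
  have -> : f b = f a + q * (b - a) by rewrite /q divfK ?gt_eqF// addrC subrK.
  by move=> h; rewrite -(ler_pM2r ba); nra.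
have : (q - k) * s <= q * a - f a by nra.
rewrite mulrC -ler_pdivlMr// /s.
by have := ler_norm ((q * a - f a) / (q - k)); lra.
Qed.

Lemma recession_gt0 : (0 < recession)%E.
Proof.
apply: lt_le_trans (@chord_slope_le_recession 1 2 ler01 (ltr_nat R 1 2)).
have f2 : 0 < f 2 by apply: f_gt0; [lra|rewrite gt_eqF//; lra].
by rewrite lte_fin f1 subr0 divr_gt0//; lra.
Qed.

(** Strict midpoint convexity of the conjugate between 0 and y.  In terms of f and
    z = 1/y it says that the chord slope (f (2z) - f z) / z is less than the
    recession; it is less than the next slope (f (3z) - f (2z)) / z. *)
Lemma fstar_double_lt (y : R) : 0 < y ->
  ((2 * fstar (y / 2))%:E < recession + (fstar y)%:E)%E.
Proof.
move=> y0.
have z0 : 0 < y^-1 by rewrite invr_gt0.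
set z := y^-1 in z0.
have z2 : z < 2 * z by lra.
have z3 : 2 * z < 3 * z by lra.
have h := chord_lt (ltW z0) z2 z3.
have := chord_slope_le_recession (ltW (lt_trans z0 z2)) z3.
have E1 : fstar (y / 2) = y / 2 * f (2 * z).
  by rewrite /fstar invf_div.
rewrite -lteBlDr// -EFinB => /(lt_le_trans _); apply.
rewrite lte_fin E1 /fstar -/z.
have -> : 3 * z - 2 * z = z by ring.
rewrite ltr_pdivlMr//.
have -> : (2 * (y / 2 * f (2 * z)) - y * f z) * z = f (2 * z) - f z.
  by rewrite /z; field; rewrite gt_eqF.
nra.
Qed.

End ConvexFunction.

(** * The divergence kernels of f and of its conjugate *)

Section Kernels.
Context {R : realType}.
Variable f : R -> R.
Hypotheses (f_ge0 : forall t, 0 <= t -> 0 <= f t)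
  (f_convex : strictly_convex_nonneg f) (f1 : f 1 = 0)
  (f_cont0 : f t @[t --> 0^'+] --> f 0).

Lemma inv_cvg_at_right0 : t^-1 @[t --> +oo] --> (0 : R)^'+.
Proof.
have c0 : t^-1 @[t --> +oo] --> (0 : R).
  by apply/gtr0_cvgV0; [exact: nbhs_pinfty_gt|exact: cvg_id].
move=> U [e /= e0 eU].
have : \forall t \near +oo, `|0 - t^-1| < e by move/cvgrPdist_lt : c0; exact.
apply: filter_app; near=> t => te; apply: eU => //=.
by rewrite invr_gt0; near: t; exact: nbhs_pinfty_gt.
Unshelve. all: by end_near. Qed.

Lemma continuous_clamp (T : topologicalType) (h : R -> T) :
  (forall x : R, 0 < x -> h y @[y --> x] --> h x) ->
  h y @[y --> 0^'+] --> h 0 ->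
  continuous (fun c : R => h (Num.max c 0)).
Proof.
move=> hpos h0 x.
have [x0|x0|->] := ltgtP x 0.
- apply: cvg_near_cst; near=> y.
  have y0 : y < 0 by near: y; exact: lt_nbhsl.
  by rewrite !max_r ?(ltW y0) ?(ltW x0).
- rewrite /continuous_at max_l ?(ltW x0)//; apply: cvg_trans (hpos _ x0).
  apply: near_eq_cvg; near=> y.
  have y0 : 0 < y by near: y; exact: lt_nbhsr.
  by rewrite max_l ?(ltW y0).
- apply/left_right_continuousP; split.
    apply: cvg_near_cst; near=> y.
    have y0 : y < 0 by near: y; exact: nbhs_left_lt.
    by rewrite max_r ?(ltW y0)// maxxx.
  rewrite maxxx; apply: cvg_trans h0; apply: near_eq_cvg; near=> y.
  have y0 : 0 < y by near: y; exact: nbhs_right_gt.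
  by rewrite max_l ?(ltW y0).
Unshelve. all: by end_near. Qed.

Let g : R -> \bar R := EFin \o f.
Let gstar : R -> \bar R := conjugate g.

Lemma slope_at_infinityE : slope_at_infinity g = recession f.
Proof.
apply/cvg_lim => //.
rewrite (_ : (fun t => _) = (fun s => (fstar f s)%:E) \o (fun t : R => t^-1)).
  exact: cvg_comp inv_cvg_at_right0 (fstar_cvg0 f_ge0 f_convex f1).
by apply/funext => t; rewrite /= /fstar invrK.
Qed.

Lemma conjugate0 : gstar 0 = recession f.
Proof.
rewrite /gstar /conjugate eqxx; apply/cvg_lim => //.
exact: (fstar_cvg0 f_ge0 f_convex f1).
Qed.

Lemma conjugate_gt0 t : 0 < t -> gstar t = (fstar f t)%:E.
Proof. by move=> t0; rewrite /gstar /conjugate gt_eqF. Qed.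

(** The quotient of the conjugate at t by t is f (1/t). *)
Lemma slope_at_infinity_conjugate : slope_at_infinity gstar = (f 0)%:E.
Proof.
apply/cvg_lim => //.
have c0 : (f s)%:E @[s --> 0^'+] --> (f 0)%:E.
  by apply: cvg_EFin => //; exact: nearW.
apply: cvg_trans (cvg_comp _ _ inv_cvg_at_right0 c0).
apply: near_eq_cvg; near=> t => /=.
have t0 : 0 < t by near: t; exact: nbhs_pinfty_gt.
by rewrite conjugate_gt0// /fstar -EFinM mulrA mulVf ?mul1r// gt_eqF.
Unshelve. all: by end_near. Qed.

Lemma divergence_kernel_EFin : divergence_kernel g.
Proof.
split; first split.
- by move=> c c0; rewrite lee_fin f_ge0.
- apply: continuous_clamp => [x x0|].
    by apply: cvg_EFin; [exact: nearW|exact: (continuous_gt0 f_ge0 f_convex)].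
  by apply: cvg_EFin; [exact: nearW|exact: f_cont0].
- move=> c d c0 d0; rewrite -EFinD -EFinM lee_fin.
  have [->|cd] := eqVneq c d; last by rewrite ltW ?midpoint_lt.
  by rewrite (_ : (d + d) / 2 = d); [lra|field].
- by move=> c d c0 d0 cd _ _; rewrite -EFinD -EFinM lte_fin midpoint_lt.
- (* The chord from 1 to 2 bounds f from below by a line of slope f 2. *)
  move=> A.
  have f2 : 0 < f 2 by apply: f_gt0 => //; rewrite gt_eqF//; lra.
  exists (`|A| / f 2 + 3) => c Bc; rewrite lee_fin.
  have B0 : 0 <= `|A| / f 2 by rewrite divr_ge0// ltW.
  have c2 : 2 < c by lra.
  have := chord_lt f_convex ler01 (ltr1n R 2) c2; rewrite f1 mul0r add0r.
  have : `|A| <= f 2 * (c - 1).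
    rewrite -ler_pdivrMl// mulrC; lra.
  have := ler_norm A; lra.
- by move=> t _; rewrite ltry.
Qed.

Lemma divergence_kernel_conjugate : divergence_kernel gstar.
Proof.
have ge0 c : 0 <= c -> (0 <= gstar c)%E.
  rewrite le_eqVlt => /predU1P[<-|c0].
    by rewrite conjugate0 ltW// recession_gt0.
  by rewrite conjugate_gt0// lee_fin mulr_ge0 ?f_ge0 ?invr_ge0 ?ltW.
have mid0 d : 0 < d -> (gstar (d / 2) < 2^-1%:E * (gstar 0 + gstar d))%E.
  move=> d0; have := fstar_double_lt f_ge0 f_convex d0.
  rewrite conjugate0 !conjugate_gt0 ?divr_gt0//.
  rewrite -(@lte_pmul2l _ 2^-1%:E)//.
  by rewrite -EFinM mulKf ?pnatr_eq0.
have mid c d : 0 <= c -> 0 <= d -> c != d ->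
    (gstar ((c + d) / 2) < 2^-1%:E * (gstar c + gstar d))%E.
  rewrite le_eqVlt => /predU1P[<-|c0].
    rewrite le_eqVlt => /predU1P[<-|d0 _]; first by rewrite eqxx.
    by rewrite add0r mid0.
  rewrite le_eqVlt => /predU1P[<- _|d0 cd].
    by rewrite addr0 addeC mid0.
  rewrite !conjugate_gt0 ?divr_gt0 ?addr_gt0// -EFinD -EFinM lte_fin.
  exact: fstar_midpoint_lt.
split => //; first split => //.
- apply: continuous_clamp => [x x0|].
    have c : (fstar f y)%:E @[y --> x] --> (fstar f x)%:E.
      apply: cvg_EFin; first exact: nearW.
      apply: cvgM; first exact: cvg_id.
      have := @continuous_comp _ _ _ (fun y : R => y^-1) f x.
      apply; first by apply: inv_continuous; rewrite gt_eqF.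
      by apply: (continuous_gt0 f_ge0 f_convex); rewrite invr_gt0.
    rewrite conjugate_gt0//; apply: cvg_trans c.
    apply: near_eq_cvg; near=> y.
    have y0 : 0 < y by near: y; exact: lt_nbhsr.
    by rewrite conjugate_gt0.
  rewrite conjugate0; apply: cvg_trans (fstar_cvg0 f_ge0 f_convex f1).
  apply: near_eq_cvg; near=> y.
  have y0 : 0 < y by near: y; exact: nbhs_right_gt.
  by rewrite conjugate_gt0.
- move=> c d c0 d0; have [->|cd] := eqVneq c d; last by rewrite ltW ?mid.
  by rewrite mean_diag (_ : (d + d) / 2 = d)//; field.
- by move=> c d c0 d0 cd _ _; exact: mid.
- (* f decreases on [0, 1], so the conjugate is at least c * f (1/2) for c >= 2. *)
  move=> A.
  have f2 : 0 < f 2^-1 by apply: f_gt0 => //; rewrite lt_eqF//; lra.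
  exists (`|A| / f 2^-1 + 2) => c Bc.
  have B0 : 0 <= `|A| / f 2^-1 by rewrite divr_ge0// ltW.
  have c0 : 0 < c by lra.
  rewrite conjugate_gt0// lee_fin /fstar.
  have fc : f 2^-1 <= f c^-1.
    have ci : c^-1 <= 2^-1 by rewrite lef_pV2 ?posrE//; lra.
    move: ci; rewrite le_eqVlt => /predU1P[->//|ci].
    have cV : 0 <= c^-1 by rewrite invr_ge0 ltW.
    have h1 : (2^-1 : R) < 1 by lra.
    have := chord_lt f_convex cV ci h1; rewrite f1 mul0r addr0.
    have := f_ge0 cV; nra.
  have : `|A| <= c * f 2^-1 by rewrite -ler_pdivrMr//; lra.
  have := ler_norm A; nra.
- by move=> t t0; rewrite conjugate_gt0// ltry.
Unshelve. all: by end_near. Qed.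

(** Each convention at a zero rate on one side is the boundary value of the kernel
    on the other side. *)
Lemma fdiv_term_conjugate m l : 0 <= m -> 0 <= l ->
  fdiv_term (slope_at_infinity g) g m l =
  fdiv_term (slope_at_infinity gstar) gstar l m.
Proof.
rewrite slope_at_infinityE slope_at_infinity_conjugate.
rewrite /fdiv_term le_eqVlt => /predU1P[<-|m0].
  by rewrite eqxx mul0r mul0e; case: eqP => // ->; rewrite mul0e.
rewrite (gt_eqF m0) le_eqVlt => /predU1P[<-|l0].
  by rewrite eqxx mul0r conjugate0.
rewrite (gt_eqF l0) conjugate_gt0 ?divr_gt0// /fstar -!EFinM invf_div.
by congr EFin; field; rewrite !gt_eqF.
Qed.

End Kernels.

(** * Centroids *)

Section Centroid.
Context {R : realType} {X : finType}.
Variables (pi : X -> R) (n : nat) (L : 'I_n -> X -> X -> R).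
Hypotheses (pi_gt0 : forall x, 0 < pi x) (hL : forall i, generator (L i)).

(** The edge x -- y receives two terms from each L i, one for each direction;
    the disjoint union of two copies of 'I_n indexes them as one family. *)
Lemma divergence_sum_has_min (phi : R -> \bar R) (kappa : \bar R) :
  divergence_kernel phi -> (0 <= kappa)%E ->
  (phi 0%R < +oo)%E \/ (kappa < +oo)%E ->
  (forall x y, x != y ->
    (exists i, 0 < L i x y \/ 0 < L i y x) \/ ((0 < kappa)%E /\ (0 < n)%N)) ->
  exists! M, is_minimizer (reversible_generator pi)
    (fun M => \sum_(i < n) fdiv_conv kappa pi phi M (L i))%E M.
Proof.
move=> hphi k0 fin charged.
pose a x y c : \bar R :=
  (\sum_(i < n) (pi x)%:E * fdiv_term kappa phi (c / pi x) (L i x y))%E.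
have L0 i x y : x != y -> 0 <= L i x y by case: (hL i) => + _; exact.
have t0 i x y m : x != y -> 0 <= m -> (0 <= fdiv_term kappa phi m (L i x y))%E.
  by move=> xy m0; rewrite fdiv_term_ge0 ?L0.
have a0 x y c : x != y -> 0 <= c -> (0 <= a x y c)%E.
  move=> xy c0; apply: sume_ge0 => i _.
  by rewrite mule_ge0 ?lee_fin ?(ltW (pi_gt0 x))// t0// divr_ge0// ltW.
have totalE M : reversible_generator pi M ->
    (\sum_(i < n) fdiv_conv kappa pi phi M (L i))%E = total_cost pi a M.
  move=> [[M0 _] _]; rewrite /total_cost /fdiv_conv exchange_big/=.
  apply: eq_bigr => x _; rewrite /a exchange_big/=.
  apply: eq_bigr => i _; rewrite ge0_sume_distrr.
    by apply: eq_bigr => y _; rewrite mulrAC divff ?mul1r// gt_eqF.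
  by move=> y; rewrite eq_sym => xy; rewrite t0 ?M0.
have [M [[MR Mmin] Muniq]] : exists! M,
    is_minimizer (reversible_generator pi) (total_cost pi a) M.
  apply: separable_has_min => // x y xy.
  pose J : finType := ('I_n + 'I_n)%type.
  pose p (j : J) := if j is inl _ then pi x else pi y.
  pose l (j : J) := match j with inl i => L i x y | inr i => L i y x end.
  have p0 j : 0 < p j by case: j => i /=; exact: pi_gt0.
  have l0 j : 0 <= l j by case: j => i /=; apply: L0; rewrite // eq_sym.
  have := weighted_divergence_has_min hphi k0 p0 l0 fin.
  have -> : (fun c => \sum_j (p j)%:E * fdiv_term kappa phi (c / p j) (l j))%E =
    edge_cost a x y by apply/funext => c; rewrite big_sumType.
  apply; have [[i [li|li]]|[kpos n0]] := charged x y xy.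
  - by left; exists (inl i).
  - by left; exists (inr i).
  - by right; split=> //; exists (inl (Ordinal n0)).
exists M; split; first by split=> // N NR; rewrite !totalE// Mmin.
by move=> N [NR Nmin]; apply: Muniq; split=> // N' N'R; rewrite -!totalE// Nmin.
Qed.

Lemma exists_unique_minimizer_ext (T : Type) (A : set T) (F G : T -> \bar R) :
  (forall M, A M -> F M = G M) ->
  (exists! M, is_minimizer A F M) -> exists! M, is_minimizer A G M.
Proof.
move=> FG [M [[AM Mmin] Muniq]]; exists M; split.
  by split=> // N AN; rewrite -!FG// Mmin.
by move=> N [AN Nmin]; apply: Muniq; split=> // N' AN'; rewrite !FG// Nmin.
Qed.

Lemma fdiv_conjugate (f : R -> R) (M N : X -> X -> R) :
  (forall t, 0 <= t -> 0 <= f t) -> strictly_convex_nonneg f -> f 1 = 0 ->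
  f t @[t --> 0^'+] --> f 0 -> generator M -> generator N ->
  fdiv pi (EFin \o f) M N = fdiv pi (conjugate (EFin \o f)) N M.
Proof.
move=> f_ge0 f_convex f1 f_cont0 [M0 _] [N0 _].
rewrite /fdiv /fdiv_conv; apply: eq_bigr => x _; congr (_ * _)%E.
apply: eq_bigr => y; rewrite eq_sym => xy.
by apply: fdiv_term_conjugate => //; [exact: M0|exact: N0].
Qed.

End Centroid.
Unset Implicit Arguments.

Theorem theorem3p9 (R : realType) (X : finType) (pi : X -> R)
    (n : nat) (L : 'I_n -> X -> X -> R) (f : R -> R)
    (hpi : probability_vector pi)
    (hn : (0 < n)%N)
    (hL : forall i, generator (L i))
    (f_ge0 : forall t, 0 <= t -> 0 <= f t)
    (f_convex : strictly_convex_nonneg f)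
    (f1 : f 1 = 0)
    (f_growth : polynomial_growth f)
    (f_cont0 : f t @[t --> 0^'+] --> f 0)
    (f_deriv1 : is_derive (1 : R) (1 : R) f 0) :
  let g : R -> \bar R := EFin \o f in
  let gstar : R -> \bar R := conjugate g in
  (* (a) *)
  [/\ forall M, reversible_generator pi M ->
        (\sum_(i < n) fdiv pi g M (L i) =
         \sum_(i < n) fdiv pi gstar (L i) M)%E,
      exists! M, is_minimizer (reversible_generator pi)
        (fun M => \sum_(i < n) fdiv pi g M (L i))%E M
    & exists! M, is_minimizer (reversible_generator pi)
        (fun M => \sum_(i < n) fdiv pi gstar (L i) M)%E M] /\
  (* (b) *)
  [/\ forall M, reversible_generator pi M ->
        (\sum_(i < n) fdiv pi g (L i) M =
         \sum_(i < n) fdiv pi gstar M (L i))%E,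
      exists! M, is_minimizer (reversible_generator pi)
        (fun M => \sum_(i < n) fdiv pi g (L i) M)%E M
    & exists! M, is_minimizer (reversible_generator pi)
        (fun M => \sum_(i < n) fdiv pi gstar M (L i))%E M] /\
  (* the forms of (a) and (b) with the L i as second argument, under the
     convention 0 f(a / 0) = 0; a pair charged by no L i would leave M free *)
  ((forall x y, x != y -> exists i, 0 < L i x y \/ 0 < L i y x) ->
     (exists! M, is_minimizer (reversible_generator pi)
        (fun M => \sum_(i < n) fdiv0 pi g M (L i))%E M) /\
     (exists! M, is_minimizer (reversible_generator pi)
        (fun M => \sum_(i < n) fdiv0 pi gstar M (L i))%E M)).
Proof.
move=> g gstar.
have pi_gt0 : forall x, 0 < pi x by case: hpi.
have kg : divergence_kernel g by exact: divergence_kernel_EFin.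
have kgs : divergence_kernel gstar by exact: divergence_kernel_conjugate.
have sg : (0 < slope_at_infinity g)%E.
  by rewrite slope_at_infinityE// recession_gt0.
have f00 : 0 < f 0 by apply: f_gt0 => //; rewrite eq_sym oner_eq0.
have sgs : slope_at_infinity gstar = (f 0)%:E by exact: slope_at_infinity_conjugate.
have idg M : reversible_generator pi M ->
    (\sum_(i < n) fdiv pi g M (L i) = \sum_(i < n) fdiv pi gstar (L i) M)%E.
  by move=> [MG _]; apply: eq_bigr => i _; exact: fdiv_conjugate.
have idgs M : reversible_generator pi M ->
    (\sum_(i < n) fdiv pi g (L i) M = \sum_(i < n) fdiv pi gstar M (L i))%E.
  by move=> [MG _]; apply: eq_bigr => i _; exact: fdiv_conjugate.
have ming : exists! M, is_minimizer (reversible_generator pi)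
    (fun M => \sum_(i < n) fdiv pi g M (L i))%E M.
  apply: divergence_sum_has_min => //; first exact: ltW.
  - by left; rewrite ltry.
  - by right.
have mings : exists! M, is_minimizer (reversible_generator pi)
    (fun M => \sum_(i < n) fdiv pi gstar M (L i))%E M.
  apply: divergence_sum_has_min; rewrite // ?sgs.
  - by rewrite lee_fin ltW.
  - by right; rewrite ltry.
  - by right; rewrite lte_fin.
split; [|split].
- by split=> //; exact: exists_unique_minimizer_ext idg ming.
- split=> //; apply: exists_unique_minimizer_ext mings => M MR.
  by rewrite idgs.
- move=> charged; split; apply: divergence_sum_has_min => //.
  + by right; rewrite ltry.
  + by move=> x y xy; left; exact: charged.
  + by right; rewrite ltry.
  + by move=> x y xy; left; exact: charged.
Qed.
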